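(* Let $d\ge 1$, let $G$ be a compact abelian group with normalized Haar measure $\mu$, and let $\{\gamma_i\}_{i=0}^{\infty}$ be a $d$-dissociated system of characters of $G$. Then the polynomial chaos $B^d_\gamma=\{\gamma_{k_1}\cdots\gamma_{k_d} : k_1\le\dots\le k_d\}$ is a $q$-lacunary system for all $q>2$. That is, for every $q\in(2,\infty)$ there is a constant $C>0$ such that for every $N$ and every polynomial $$Q={\sum}' A_{k_1,\ldots,k_d}\,\gamma_{k_1}(x)\cdots\gamma_{k_d}(x),\qquad A_{k_1,\ldots,k_d}\in\mathbb{C},$$ one has $$\|Q\|_{q}\le C\Bigl({\sum}'|A_{k_1,\ldots,k_d}|^2\Bigr)^{1/2},$$ where $C$ does not depend on the polynomial $Q$. Here the primed sum $\sum'$ runs over all non-decreasing sequences $0\le k_1\le\dots\le k_d\le N$ in which each index $j\in\{0,1,\ldots,N\}$ appears fewer than $m_j$ times, where $m_j=\inf\{m\in\mathbb{N}\cup\{+\infty\}:\gamma_j^m=1\}$.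
   Context: A character of a compact abelian group $G$ is a continuous homomorphism from $G$ to the unit circle. $\|\cdot\|_q$ is the norm of $L_q(G)$ with respect to normalized Haar measure. $m_j\in\mathbb{N}\cup\{+\infty\}$ is the order of the character $\gamma_j$ ($m_j=+\infty$ if no positive power of $\gamma_j$ is trivial). A finite set $\{\gamma_1,\ldots,\gamma_m\}$ of distinct characters of $G$ is called $d$-dissociated if it does not contain the trivial character and if any relation $\gamma_1^{k_1}\gamma_2^{k_2}\cdots\gamma_m^{k_m}\equiv 1$ with all $k_j\in\{-d,-(d-1),\ldots,0,\ldots,d-1,d\}$ implies $\gamma_1^{k_1}\equiv\gamma_2^{k_2}\equiv\dots\equiv\gamma_m^{k_m}\equiv1$. An infinite set of characters is $d$-dissociated if every finite subset of it is $d$-dissociated. In a $d$-dissociated system $\{\gamma_i\}$ the characters $\gamma_i$ are pairwise distinct. *)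

(* Defs.v *)
From HB Require Import structures.
From mathcomp Require Import all_boot all_order all_algebra.
From mathcomp Require Import all_classical all_reals all_analysis.
From mathcomp Require Import complex.

Set Implicit Arguments.
Unset Strict Implicit.
Unset Printing Implicit Defensive.

Import Order.TTheory GRing.Theory Num.Theory.
Import numFieldNormedType.Exports.

Local Open Scope classical_set_scope.
Local Open Scope ring_scope.
Local Open Scope complex_scope.

(* A measurableType must be pointed, which an abstract topological group is
   not; this alias of its carrier is pointed at 0. *)
Definition pointed_group (G : topologicalZmodType) : Type := G.

HB.instance Definition _ (G : topologicalZmodType) :=
  Choice.copy (pointed_group G) G.
HB.instance Definition _ (G : topologicalZmodType) :=
  isPointed.Build (pointed_group G) (0 : G).

Definition borelType (G : topologicalZmodType) :=
  g_sigma_algebraType (@open G : set (set (pointed_group G))).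

Definition borel_set (G : topologicalZmodType) : set (set G) :=
  @measurable _ (borelType G).

(* Haar measure is understood to be a Radon measure; on a group that is not
   second countable, regularity does not follow from invariance. *)
Definition normalized_haar (R : realType) (G : topologicalZmodType)
    (mu : {measure set (borelType G) -> \bar R}) : Prop :=
  [/\ mu setT = 1%E,
      forall (g : G) (A : set G), borel_set A ->
        mu [set g + x | x in A] = mu A,
      forall A : set G, borel_set A ->
        mu A = ereal_inf [set mu U | U in [set U : set G | open U /\ A `<=` U]]
    & forall U : set G, open U ->
        mu U = ereal_sup [set mu K | K in
                            [set K : set G | compact K /\ K `<=` U]] ].

Section characters.
Context (R : realType) (G : topologicalZmodType).
Implicit Types (chi : G -> R[i]) (gamma : nat -> G -> R[i]).

(* The group is written additively; R[i]^o carries the topology of the modulus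
   on the complex numbers. *)
Definition is_character chi : Prop :=
  [/\ continuous (chi : G -> R[i]^o),
      {morph chi : x y / x + y >-> x * y}
    & forall x, `|chi x| = 1 ].

(* The order of chi, equal to +oo when no positive power of chi is trivial. *)
Definition character_order chi : \bar R :=
  ereal_inf [set (n%:R)%:E | n in
               [set n : nat | (0 < n)%N /\ forall x, chi x ^+ n = 1]].

(* The finite set of characters is presented by an enumeration, whose
   injectivity is required where this predicate is used. *)
Definition dissociated_family (d m : nat) (chi : 'I_m -> G -> R[i]) : Prop :=
  (forall j, chi j <> cst 1) /\
  forall k : 'I_m -> int, (forall j, - d%:Z <= k j <= d%:Z) ->
    (forall x, \prod_(j < m) chi j x ^ k j = 1) ->
    forall j x, chi j x ^ k j = 1.

Definition dissociated_set (d : nat) (X : set (G -> R[i])) : Prop :=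
  forall (m : nat) (chi : 'I_m -> G -> R[i]),
    injective chi -> (forall j, X (chi j)) -> dissociated_family d chi.

Definition dissociated_system (d : nat) gamma : Prop :=
  [/\ forall i, is_character (gamma i),
      injective gamma
    & dissociated_set d (range gamma)].

(* The index set of the primed sum. *)
Definition chaos_index gamma (d N : nat) (k : d.-tuple 'I_N.+1) : bool :=
  sorted leq [seq val i | i <- k] &&
  [forall j : 'I_N.+1,
     `[< (((count_mem j k)%:R)%:E < character_order (gamma j))%E >] ].

Definition chaos_poly gamma (d N : nat) (A : d.-tuple 'I_N.+1 -> R[i]) (x : G)
    : R[i] :=
  \sum_(k : d.-tuple 'I_N.+1 | chaos_index gamma k)
     A k * \prod_(i < d) gamma (tnth k i) x.

End characters.

Definition cmod (R : realType) (z : R[i]) : R := ComplexField.Normc.normc z.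

(* Lnorm takes extended-real functions, hence the modulus. *)
Definition complex_Lnorm (R : realType) (G : topologicalZmodType)
    (mu : {measure set (borelType G) -> \bar R}) (q : R) (f : G -> R[i])
    : \bar R :=
  Lnorm mu q%:E (fun x => (cmod (f x))%:E).

(* Main.v *)
(* Call functions phi_j of modulus at most 1 weakly multiplicative
   if every product of distinct phi_j or conjugates has mean zero.  Let z_j be
   independent and uniform on {1, i, -1, -i}.  The Riesz product
   K(x, z) = prod_j (1 + Re (phi_j(x) conj(z_j))) is nonnegative with mean 1 in x
   and in z, and the z-average of z_S K(x, z) is 2^-|S| phi_S(x).  Hence
   sum_S c_S phi_S is the conditional expectation of sum_S 2^|S| c_S z_S in the
   coupling with density K, and Jensen's inequality bounds its L_{2P} norm by
   that of a polynomial in the z_j, which Bonami's hypercontractive inequality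
   controls by the l_2 norm of the coefficients.

   Monomials of the chaos have repeated factors, so choose independent uniform
   exponents kappa_j in {1, ..., d}.  The chaos polynomial is an average over
   kappa of multilinear polynomials in the gamma_j^kappa_j, and d-dissociation
   implies that the nontrivial ones among these characters are weakly
   multiplicative. *)
Require Import Defs.
From mathcomp Require Import all_boot all_order all_algebra.
From mathcomp Require Import all_classical all_reals all_analysis.
From mathcomp Require Import complex.
From mathcomp Require Import measurable_realfun zify ring lra.

Set Implicit Arguments.
Unset Strict Implicit.
Unset Printing Implicit Defensive.

Import Order.TTheory GRing.Theory Num.Theory.
Import numFieldNormedType.Exports.

Local Open Scope classical_set_scope.
Local Open Scope ring_scope.
Local Open Scope complex_scope.

(** * Power means and the two-point inequality *)

(** Induction by squaring: the case of the square is nonnegativity of the variance, and the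
    induction hypothesis is applied to the squares of [x]. *)
Lemma pow2_jensen (R : realFieldType) (I : finType) (w x : I -> R) (m : nat) :
  (forall i, 0 <= w i) -> \sum_i w i = 1 ->
  (\sum_i w i * x i) ^+ (2 ^ m) <= \sum_i w i * x i ^+ (2 ^ m).
Proof.
move=> w0 w1; elim: m x => [|m IH] x.
  by rewrite expr1 ler_sum// => i _; rewrite expr1.
rewrite expnS exprM.
under [leRHS]eq_bigr do rewrite exprM.
apply: le_trans (IH _).
rewrite lerXn2r ?nnegrE ?sqr_ge0 ?sumr_ge0//.
  by move=> i _; rewrite mulr_ge0 ?sqr_ge0.
set M := \sum_i w i * x i.
have : 0 <= \sum_i w i * (x i - M) ^+ 2.
  by apply: sumr_ge0 => i _; rewrite mulr_ge0 ?sqr_ge0.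
have -> : \sum_i w i * (x i - M) ^+ 2
    = \sum_i w i * x i ^+ 2 - 2 * M * M + M ^+ 2.
  rewrite (eq_bigr (fun i => w i * x i ^+ 2 - 2 * M * (w i * x i) + w i * M ^+ 2)).
    by rewrite big_split sumrB -mulr_sumr -mulr_suml w1 mul1r.
  by move=> i _; ring.
by lra.
Qed.

(** Minkowski's inequality from Jensen's: [(u i + v i) / (a + b)] is the convex combination of
    [u i / a] and [v i / b] with weights proportional to [a] and [b]. If [a] or [b] is 0, the
    corresponding function vanishes. *)
Lemma pow2_minkowski (R : realFieldType) (I : finType) (u v : I -> R)
    (a b : R) (m : nat) :
  (forall i, 0 <= u i) -> (forall i, 0 <= v i) -> 0 <= a -> 0 <= b ->
  \sum_i u i ^+ (2 ^ m) <= #|I|%:R * a ^+ (2 ^ m) ->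
  \sum_i v i ^+ (2 ^ m) <= #|I|%:R * b ^+ (2 ^ m) ->
  \sum_i (u i + v i) ^+ (2 ^ m) <= #|I|%:R * (a + b) ^+ (2 ^ m).
Proof.
have P0 : (2 ^ m)%N != 0%N by rewrite expn_eq0.
have sum0 (g : I -> R) : (forall i, 0 <= g i) ->
    \sum_i g i ^+ (2 ^ m) <= 0 -> forall i, g i = 0.
  move=> g0 g_le0 i; apply/eqP.
  suff : g i ^+ (2 ^ m) == 0 by rewrite expf_eq0 => /andP[].
  apply/eqP; move: i isT; apply/psumr_eq0P => [j _|]; first exact: exprn_ge0.
  by apply/eqP; rewrite eq_le g_le0 sumr_ge0// => j _; exact: exprn_ge0.
move=> u0 v0; rewrite le_eqVlt => /predU1P[<- b0|a0].
  rewrite expr0n (negPf P0) mulr0 add0r => /(sum0 _ u0) u_eq0.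
  by apply: le_trans; apply: ler_sum => i _; rewrite u_eq0 add0r.
rewrite le_eqVlt => /predU1P[<- |b0].
  rewrite expr0n (negPf P0) mulr0 addr0 => + /(sum0 _ v0) v_eq0.
  by apply: le_trans; apply: ler_sum => i _; rewrite v_eq0 addr0.
move=> ua vb; have ab0 : 0 < a + b by rewrite addr_gt0.
pose w (c : bool) := (if c then a else b) / (a + b).
have wJ i : (u i + v i) ^+ (2 ^ m) <= (a + b) ^+ (2 ^ m) *
    (w true * (u i / a) ^+ (2 ^ m) + w false * (v i / b) ^+ (2 ^ m)).
  have := @pow2_jensen R bool w (fun c => if c then u i / a else v i / b) m.
  rewrite !big_bool /= => J.
  rewrite (_ : u i + v i = (a + b) * (w true * (u i / a) + w false * (v i / b))).
    rewrite exprMn ler_pM2l ?exprn_gt0//; apply: J.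
      by case; rewrite /w divr_ge0// ltW.
    by rewrite /w -mulrDl divff// gt_eqF.
  by rewrite /w; field; rewrite !gt_eqF.
apply: le_trans (ler_sum _ (fun i _ => wJ i)) _.
rewrite -mulr_sumr mulrC ler_pM2r ?exprn_gt0// big_split -!mulr_sumr /=.
under eq_bigr do rewrite exprMn.
under [X in _ + _ * X]eq_bigr do rewrite exprMn.
rewrite -!mulr_suml.
have -> : #|I|%:R = w true * #|I|%:R + w false * #|I|%:R.
  by rewrite /w -mulrDl -mulrDl divff ?mul1r// gt_eqF.
have w0 c : 0 <= w c by case: c; rewrite /w divr_ge0// ltW.
by rewrite lerD// ler_wpM2l// exprVn ler_pdivrMr ?exprn_gt0.
Qed.

(* For [v = t ^+ 2 * u] and [w = t * u] this is Bonami's two-point inequality;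
   doubling the exponent replaces (u, v, w) by
   ((u + v) ^+ 2, 4 * w ^+ 2, 2 * (u + v) * w). *)
Lemma two_point (R : realFieldType) (m : nat) (u v w : R) :
  0 <= u -> 0 <= v -> w ^+ 2 <= u * v ->
  (u + v + 2 * w) ^+ (2 ^ m) + (u + v - 2 * w) ^+ (2 ^ m)
    <= 2 * (u + (2 ^+ m.+1 - 1) * v) ^+ (2 ^ m).
Proof.
elim: m u v w => [|m IH] u v w u0 v0 wuv; first by rewrite !expr1; lra.
rewrite expnS !exprM.
have := IH ((u + v) ^+ 2) (4 * w ^+ 2) (2 * (u + v) * w).
rewrite (_ : (u + v) ^+ 2 + 4 * w ^+ 2 + _ = (u + v + 2 * w) ^+ 2); last by ring.
rewrite (_ : (u + v) ^+ 2 + 4 * w ^+ 2 - _ = (u + v - 2 * w) ^+ 2); last by ring.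
have c1 : 1 <= (2 : R) ^+ m by apply: exprn_ege1; lra.
move=> /(_ (sqr_ge0 _)) => {}IH; apply: le_trans (IH _ _) _.
- by rewrite mulr_ge0// sqr_ge0.
- by rewrite le_eqVlt; apply/orP; left; apply/eqP; ring.
set c := 2 ^+ m in c1 *.
have uv0 : 0 <= u * v by rewrite mulr_ge0.
have c0 : 0 <= 2 ^+ m.+1 - 1 :> R by rewrite exprS; move: c1; rewrite /c; lra.
rewrite ler_pM2l// lerXn2r ?nnegrE//.
  by rewrite addr_ge0 ?sqr_ge0// mulr_ge0// mulr_ge0// sqr_ge0.
  exact: sqr_ge0.
have e1 : 2 ^+ m.+1 = 2 * c :> R by rewrite exprS.
rewrite [2 ^+ m.+2]exprS e1 in c0 *.
(* Once [w ^+ 2] is replaced by [u * v], the coefficients of [u * v] on the two sides agree, and the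
   difference is the multiple of [v ^+ 2] treated next. *)
apply: (@le_trans _ _ ((u + v) ^+ 2 + (2 * c - 1) * (4 * (u * v)))).
  rewrite lerD2l ler_wpM2l//; lra.
have : 0 <= ((2 * (2 * c) - 1) ^+ 2 - 1) * v ^+ 2.
  rewrite mulr_ge0 ?sqr_ge0//; nra.
rewrite !expr2; nra.
Qed.

(** * Hypercontractivity *)

Section cmod.
Context (R : realType).
Implicit Types a b z : R[i].

Lemma cmod_ge0 z : 0 <= cmod z.
Proof. by case: z => x y; exact: sqrtr_ge0. Qed.

Lemma sqr_cmod z : cmod z ^+ 2 = complex.Re z ^+ 2 + complex.Im z ^+ 2.
Proof. by case: z => x y; rewrite sqr_sqrtr// addr_ge0 ?sqr_ge0. Qed.

Lemma cmod0 : cmod (0 : R[i]) = 0.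
Proof. exact: ComplexField.Normc.normc0. Qed.

Lemma cmod1 : cmod (1 : R[i]) = 1.
Proof. exact: ComplexField.Normc.normc1. Qed.

Lemma cmodM a b : cmod (a * b) = cmod a * cmod b.
Proof. exact: ComplexField.Normc.normcM. Qed.

Lemma cmodD a b : cmod (a + b) <= cmod a + cmod b.
Proof. exact: le_normcD. Qed.

Lemma cmod_sum (I : finType) (P : pred I) (f : I -> R[i]) :
  cmod (\sum_(i | P i) f i) <= \sum_(i | P i) cmod (f i).
Proof.
elim/big_ind2 : _ => [|a x b y ax bY|//]; first by rewrite cmod0.
by apply: le_trans (cmodD _ _) _; exact: lerD.
Qed.

Lemma cmod_real (x : R) : 0 <= x -> cmod x%:C = x.
Proof. by move=> x0; rewrite /cmod /= expr0n/= addr0 sqrtr_sqr ger0_norm. Qed.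

Lemma cmod_ge_Re z : `|complex.Re z| <= cmod z.
Proof. by have := normc_ge_Re z; rewrite lecR. Qed.

Lemma cmod_ge_Im z : `|complex.Im z| <= cmod z.
Proof.
by case: z => x y; rewrite -sqrtr_sqr ler_wsqrtr// lerDr sqr_ge0.
Qed.

Lemma cmodJ z : cmod (conjc z) = cmod z.
Proof. by case: z => x y; rewrite /cmod /= sqrrN. Qed.

(** [two_point] is applied to squared moduli. The cross term [w] is the real inner product of [a]
    and [b], and Lagrange's identity supplies the Cauchy-Schwarz hypothesis. *)
Lemma two_point_complex (m : nat) a b :
  cmod (a + b) ^+ (2 ^ m.+1) + cmod (a - b) ^+ (2 ^ m.+1)
    <= 2 * (cmod a ^+ 2 + (2 ^+ m.+1 - 1) * cmod b ^+ 2) ^+ (2 ^ m).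
Proof.
rewrite expnS !exprM; pose w := complex.Re a * complex.Re b + complex.Im a * complex.Im b.
have -> : cmod (a + b) ^+ 2 = cmod a ^+ 2 + cmod b ^+ 2 + 2 * w.
  by rewrite !sqr_cmod /w {w}; case: a b => [? ?] [? ?] /=; ring.
have -> : cmod (a - b) ^+ 2 = cmod a ^+ 2 + cmod b ^+ 2 - 2 * w.
  by rewrite !sqr_cmod /w {w}; case: a b => [? ?] [? ?] /=; ring.
apply: two_point; rewrite ?sqr_ge0// !sqr_cmod /w -subr_ge0.
rewrite (_ : _ - _ =
  (complex.Re a * complex.Im b - complex.Im a * complex.Re b) ^+ 2) ?sqr_ge0//.
by ring.
Qed.

End cmod.

(* For uniform e, [quarter e] is a fourth root of unity with mean 0, mean square 0
   and mean squared modulus 1. *)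
Definition quarter {R : realType} (e : bool * bool) : R[i] :=
  (-1) ^+ e.1 * 'i%C ^+ e.2.

Lemma cmod_quarter (R : realType) (e : bool * bool) : cmod (quarter e : R[i]) = 1.
Proof.
rewrite /quarter cmodM.
have h (z : R[i]) (b : bool) : cmod z = 1 -> cmod (z ^+ b) = 1.
  by case: b => //= _; exact: cmod1.
rewrite !h ?mul1r//; last by rewrite /cmod /= expr0n expr1n add0r sqrtr1.
by rewrite [LHS]normcN; exact: cmod1.
Qed.

Section hypercontractivity.
Context (R : realType) (T : finType).
Implicit Types (c : {set T} -> R[i]) (U S : {set T}) (z : {ffun T -> bool * bool}).

Definition multilinear c U z : R[i] :=
  \sum_(S in powerset U) c S * \prod_(j in S) quarter (z j).

Lemma sum_powersetU1 (V : nmodType) (t : T) U (f : {set T} -> V) : t \notin U ->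
  \sum_(S in powerset (t |: U)) f S
  = \sum_(S in powerset U) f S + \sum_(S in powerset U) f (t |: S).
Proof.
move=> tU; rewrite (bigID (fun S => t \in S)) /= addrC; congr (_ + _).
  apply: eq_bigl => S; rewrite !powersetE; apply/andP/idP => [[SU tS]|SU].
    by rewrite -(finset.setU1K tU) subsetD1 SU.
  split; first by rewrite (fintype.subset_trans SU)// finset.subsetUr.
  by apply: contra tU => /(fintype.subsetP SU).
rewrite (reindex_onto (fun S => t |: S) (fun S => S :\ t)) /=; last first.
  by move=> S /andP[_ tS]; rewrite finset.setD1K.
apply: eq_bigl => S; rewrite !powersetE setU11 andbT.
apply/andP/idP => [[SU /eqP <-]|SU].
  by rewrite -(finset.setU1K tU) finset.setSD.
by rewrite finset.setUS// finset.setU1K//; apply: contra tU => /(fintype.subsetP SU).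
Qed.

Lemma multilinearU1 c t U z : t \notin U ->
  multilinear c (t |: U) z
  = multilinear c U z + quarter (z t) * multilinear (fun S => c (t |: S)) U z.
Proof.
move=> tU; rewrite /multilinear sum_powersetU1//; congr (_ + _).
rewrite mulr_sumr; apply: eq_bigr => S; rewrite powersetE => SU.
rewrite big_setU1/= 1?mulrCA//; by apply: contra tU => /(fintype.subsetP SU).
Qed.

(** Changes the sign of [quarter (z t)] only; reindexing a sum over [z] by this involution produces
    the pair of signs in the two-point inequality. *)
Definition flip (t : T) z : {ffun T -> bool * bool} :=
  [ffun j => if j == t then (~~ (z j).1, (z j).2) else z j].

Lemma flipK t : involutive (flip t).
Proof.
move=> z; apply/ffunP => j; rewrite !ffunE; case: eqP => //= _.
by rewrite negbK; case: (z j).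
Qed.

Lemma quarter_flip t z : quarter (flip t z t) = - quarter (z t) :> R[i].
Proof.
rewrite ffunE eqxx /quarter /=; case: (z t).1 => /=.
  by rewrite expr0 expr1 mul1r mulN1r opprK.
by rewrite expr0 expr1 mul1r mulN1r.
Qed.

Lemma multilinear_flip c t U z : t \notin U ->
  multilinear c U (flip t z) = multilinear c U z.
Proof.
move=> tU; apply: eq_bigr => S; rewrite powersetE => SU; congr (_ * _).
apply: eq_bigr => j jS; rewrite ffunE; case: eqP => // jt.
by move: tU; rewrite -jt (fintype.subsetP SU _ jS).
Qed.

(** Induction on [#|U|]. Splitting off [t] writes the polynomial as [a z + quarter (z t) * b z],
    where [a] and [b] ignore the sign of [quarter (z t)]. Symmetrising that sign allows the
    two-point inequality; Minkowski's inequality then separates the squared moduli of [a] and [b],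
    to which the induction hypothesis applies. *)
Lemma hypercontractivity c U (m : nat) :
  \sum_z cmod (multilinear c U z) ^+ (2 ^ m.+1)
  <= #|{ffun T -> bool * bool}|%:R *
     (\sum_(S in powerset U) (2 ^+ m.+1 - 1) ^+ #|S| * cmod (c S) ^+ 2) ^+ (2 ^ m).
Proof.
have K0 : 0 <= 2 ^+ m.+1 - 1 :> R by rewrite subr_ge0 exprn_ege1// ler1n.
have [n] := ubnP #|U|; elim: n c U => // n IH c U.
have [->|[t tU]] := set_0Vmem U => [_|].
  rewrite /multilinear powerset0 big_set1 cards0 expr0 mul1r.
  under eq_bigr do rewrite big_set1 big_set0 mulr1.
  by rewrite expnS exprM sumr_const cardT -cardT mulr_natl.
rewrite (cardsD1 t) tU add1n ltnS => Un.
rewrite -(finset.setD1K tU); have tU' : t \notin U :\ t by rewrite !inE eqxx.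
move: (U :\ t) Un tU' => {tU}U Un tU.
pose a := multilinear c U; pose b := multilinear (fun S => c (t |: S)) U.
have sym : \sum_z cmod (multilinear c (t |: U) z) ^+ (2 ^ m.+1) * 2 =
    \sum_z (cmod (a z + quarter (z t) * b z) ^+ (2 ^ m.+1)
            + cmod (a z - quarter (z t) * b z) ^+ (2 ^ m.+1)).
  rewrite -mulr_suml mulr_natr mulr2n big_split /=; congr (_ + _).
    by apply: eq_bigr => z _; rewrite multilinearU1.
  rewrite (reindex_inj (inv_inj (flipK t))); apply: eq_bigr => z _.
  by rewrite multilinearU1// quarter_flip !multilinear_flip// mulNr.
rewrite -(@ler_pM2r _ 2)// mulr_suml sym.
apply: le_trans (ler_sum _ (fun z _ => two_point_complex m _ _)) _.
rewrite -mulr_sumr mulrC ler_pM2r// sum_powersetU1//.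
under eq_bigr do rewrite cmodM cmod_quarter mul1r.
apply: pow2_minkowski.
- by move=> z; rewrite sqr_ge0.
- by move=> z; rewrite mulr_ge0 ?sqr_ge0.
- by apply: sumr_ge0 => S _; rewrite mulr_ge0 ?sqr_ge0// exprn_ge0.
- by apply: sumr_ge0 => S _; rewrite mulr_ge0 ?sqr_ge0// exprn_ge0.
- apply: le_trans (IH c U Un); apply: ler_sum => z _.
  by rewrite -exprM -expnS.
have := IH (fun S => c (t |: S)) U Un.
(* This multiplication puts one more factor [2 ^+ m.+1 - 1] into each term, accounting for the extra
   element of [t |: S]. *)
rewrite -(@ler_pM2l _ ((2 ^+ m.+1 - 1) ^+ (2 ^ m))); last first.
  by rewrite exprn_gt0// subr_gt0 exprn_egt1// ltr1n.
rewrite mulrCA -exprMn mulr_sumr mulr_sumr => H.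
apply: le_trans (le_trans H _).
  by apply: ler_sum => z _; rewrite exprMn -exprM -expnS.
rewrite ler_wpM2l// le_eqVlt; apply/orP; left; apply/eqP; congr (_ ^+ _).
apply: eq_bigr => S; rewrite powersetE => SU.
rewrite mulrA -exprS cardsU1; congr (_ ^+ _ * _).
by rewrite (contra _ tU)//; exact: (fintype.subsetP SU).
Qed.

End hypercontractivity.

(** * Bounded measurable functions *)

Section complex_sums.
Context (R : realType).

Lemma Re_addc (a b : R[i]) : complex.Re (a + b) = complex.Re a + complex.Re b.
Proof. by case: a b => [? ?] [? ?]. Qed.

Lemma Re_mulc (a b : R[i]) : complex.Re (a * b)
  = complex.Re a * complex.Re b - complex.Im a * complex.Im b.
Proof. by case: a b => [? ?] [? ?]. Qed.

Lemma Im_mulc (a b : R[i]) : complex.Im (a * b)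
  = complex.Re a * complex.Im b + complex.Im a * complex.Re b.
Proof. by case: a b => [? ?] [? ?]. Qed.

Lemma Re_sum (I : finType) (P : pred I) (f : I -> R[i]) :
  complex.Re (\sum_(i | P i) f i) = \sum_(i | P i) complex.Re (f i).
Proof. exact: (big_morph _ Re_addc). Qed.

Lemma sum_quarter (V : nmodType) (f : bool * bool -> V) :
  \sum_e f e = f (true, true) + f (true, false) + (f (false, true) + f (false, false)).
Proof.
rewrite (eq_bigr (fun e => f (e.1, e.2))); last by case.
by rewrite -(pair_bigA _ (fun a b => f (a, b))) big_bool !big_bool.
Qed.

Lemma quarterE : ((quarter (true, true) = - 'i%C :> R[i]) *
  (quarter (true, false) = -1 :> R[i]) * (quarter (false, true) = 'i%C :> R[i]) *
  (quarter (false, false) = 1 :> R[i]))%type.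
Proof. by do !split; rewrite /quarter /= ?expr0 ?expr1 ?mul1r ?mulr1 ?mulN1r. Qed.

End complex_sums.

Section bounded_functions.
Context (R : realType) (d : measure_display) (X : measurableType d).
Context (mu : {measure set X -> \bar R}) (mu1 : mu setT = 1%E).
Implicit Types (f g : X -> R) (h k : X -> R[i]).

(** Closed under sums and products and, as [mu] has mass 1, contained in the integrable functions;
    this settles integrability for all polynomials below. *)
Definition bounded_measurable f :=
  measurable_fun setT f /\ exists M, forall x, `|f x| <= M.

Lemma bounded_measurable_integrable f :
  bounded_measurable f -> mu.-integrable setT (EFin \o f).
Proof.
move=> [mf [M fM]]; apply: measurable_bounded_integrable => //.
  by rewrite mu1 ltry.
exists M; split; first exact: num_real.
by move=> N MN x _; apply: le_trans (fM x) (ltW MN).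
Qed.

Lemma bounded_measurable_cst (a : R) : bounded_measurable (fun=> a).
Proof. by split; [exact: measurable_cst|exists `|a|]. Qed.

Lemma bounded_measurableD f g : bounded_measurable f -> bounded_measurable g ->
  bounded_measurable (fun x => f x + g x).
Proof.
move=> [mf [M fM]] [mg [N gN]]; split; first exact: measurable_funD.
by exists (M + N) => x; rewrite (le_trans (ler_normD _ _))// lerD.
Qed.

Lemma bounded_measurableM f g : bounded_measurable f -> bounded_measurable g ->
  bounded_measurable (fun x => f x * g x).
Proof.
move=> [mf [M fM]] [mg [N gN]]; split; first exact: measurable_funM.
by exists (M * N) => x; rewrite normrM ler_pM.
Qed.

Lemma bounded_measurableX f n : bounded_measurable f ->
  bounded_measurable (fun x => f x ^+ n).
Proof.
move=> bf; elim: n => [|n IH]; first exact: bounded_measurable_cst.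
rewrite (_ : (fun x => _) = (fun x => f x * f x ^+ n)).
  exact: bounded_measurableM.
by apply/funext => x; rewrite exprS.
Qed.

Lemma bounded_measurable_sum (I : finType) (P : pred I) (f : I -> X -> R) :
  (forall i, bounded_measurable (f i)) ->
  bounded_measurable (fun x => \sum_(i | P i) f i x).
Proof.
move=> bf; rewrite (_ : (fun x => _) = \sum_(i | P i) f i); last by rewrite fct_sumE.
elim/big_ind : _ => [|a b|i _]; [exact: bounded_measurable_cst| |exact: bf].
exact: bounded_measurableD.
Qed.

Lemma Rintegral_sum (I : finType) (f : I -> X -> R) :
  (forall i, bounded_measurable (f i)) ->
  \int[mu]_x (\sum_i f i x) = \sum_i \int[mu]_x f i x.
Proof.
move=> bf.
suff [] : bounded_measurable (fun x => \sum_i f i x) /\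
  \int[mu]_x (\sum_i f i x) = \sum_i \int[mu]_x f i x by [].
rewrite (_ : (fun x => _) = \sum_i f i); last by rewrite fct_sumE.
apply: (big_ind2 (fun (u : X -> R) (v : R) =>
  bounded_measurable u /\ \int[mu]_x u x = v)).
- split; first exact: bounded_measurable_cst.
  by rewrite Rintegral_cst// mul0r.
- move=> u a v b [bu <-] [bv <-]; split; first exact: bounded_measurableD.
  by rewrite RintegralD//; exact: bounded_measurable_integrable.
- by move=> i _; split.
Qed.

Lemma RintegralZ f (a : R) : bounded_measurable f ->
  \int[mu]_x (a * f x) = a * \int[mu]_x f x.
Proof. by move=> bf; rewrite RintegralZl//; exact: bounded_measurable_integrable. Qed.

Definition cbounded_measurable h :=
  bounded_measurable (fun x => complex.Re (h x)) /\
  bounded_measurable (fun x => complex.Im (h x)).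

Lemma cbounded_measurable_cst (a : R[i]) : cbounded_measurable (fun=> a).
Proof. by split; exact: bounded_measurable_cst. Qed.

Lemma cbounded_measurableD h k : cbounded_measurable h -> cbounded_measurable k ->
  cbounded_measurable (fun x => h x + k x).
Proof.
move=> [h1 h2] [k1 k2]; split.
  rewrite (_ : (fun x => _) = (fun x => complex.Re (h x) + complex.Re (k x))).
    exact: bounded_measurableD.
  by apply/funext => x; case: (h x) (k x) => [? ?] [? ?].
rewrite (_ : (fun x => _) = (fun x => complex.Im (h x) + complex.Im (k x))).
  exact: bounded_measurableD.
by apply/funext => x; case: (h x) (k x) => [? ?] [? ?].
Qed.

Lemma bounded_measurableN f : bounded_measurable f ->
  bounded_measurable (fun x => - f x).
Proof.
move=> bf; rewrite (_ : (fun x => _) = (fun x => -1 * f x)).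
  by apply: bounded_measurableM => //; exact: bounded_measurable_cst.
by apply/funext => x; rewrite mulN1r.
Qed.

Lemma cbounded_measurableM h k : cbounded_measurable h -> cbounded_measurable k ->
  cbounded_measurable (fun x => h x * k x).
Proof.
move=> [h1 h2] [k1 k2]; split.
  under eq_fun do rewrite Re_mulc.
  apply: bounded_measurableD; last apply: bounded_measurableN;
    exact: bounded_measurableM.
under eq_fun do rewrite Im_mulc.
by apply: bounded_measurableD; exact: bounded_measurableM.
Qed.

Lemma cbounded_measurableJ h : cbounded_measurable h ->
  cbounded_measurable (fun x => conjc (h x)).
Proof.
move=> [h1 h2]; split.
  by rewrite (_ : (fun x => _) = (fun x => complex.Re (h x)))//;
    apply/funext => x; case: (h x).
rewrite (_ : (fun x => _) = (fun x => - complex.Im (h x))).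
  exact: bounded_measurableN.
by apply/funext => x; case: (h x).
Qed.

Lemma cbounded_measurable_sum (I : finType) (P : pred I) (h : I -> X -> R[i]) :
  (forall i, cbounded_measurable (h i)) ->
  cbounded_measurable (fun x => \sum_(i | P i) h i x).
Proof.
move=> bh; rewrite (_ : (fun x => _) = \sum_(i | P i) h i); last by rewrite fct_sumE.
elim/big_ind : _ => [|a b|i _]; [exact: cbounded_measurable_cst| |exact: bh].
exact: cbounded_measurableD.
Qed.

Lemma cbounded_measurable_prod (I : finType) (P : pred I) (h : I -> X -> R[i]) :
  (forall i, cbounded_measurable (h i)) ->
  cbounded_measurable (fun x => \prod_(i | P i) h i x).
Proof.
move=> bh; rewrite (_ : (fun x => _) = \prod_(i | P i) h i); last by rewrite fct_prodE.
elim/big_ind : _ => [|a b|i _]; [exact: cbounded_measurable_cst| |exact: bh].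
exact: cbounded_measurableM.
Qed.

Lemma bounded_measurable_cmod h n : cbounded_measurable h ->
  bounded_measurable (fun x => cmod (h x) ^+ n).
Proof.
move=> [[m1 [M bM]] [m2 [N bN]]]; apply: bounded_measurableX; split.
  rewrite (_ : (fun x => _) =
    (fun x => Num.sqrt (complex.Re (h x) ^+ 2 + complex.Im (h x) ^+ 2))).
    apply: (measurableT_comp (continuous_measurable_fun (@sqrt_continuous R))).
    by apply: measurable_funD; exact: measurable_funX.
  by apply/funext => x; rewrite -sqr_cmod sqrtr_sqr ger0_norm// cmod_ge0.
exists (M + N) => x; rewrite ger0_norm ?cmod_ge0//.
rewrite -ler_sqr ?nnegrE ?cmod_ge0//; last first.
  by rewrite addr_ge0// (le_trans _ (bM x), le_trans _ (bN x)).
rewrite sqr_cmod -[complex.Re _ ^+ 2]real_normK ?num_real//.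
rewrite -[complex.Im _ ^+ 2]real_normK ?num_real//.
have [a0 b0] := (normr_ge0 (complex.Re (h x)), normr_ge0 (complex.Im (h x))).
have := bM x; have := bN x; nra.
Qed.

End bounded_functions.

(** * Riesz products *)

Lemma sum_option (V : nmodType) (I : finType) (f : option I -> V) :
  \sum_o f o = f None + \sum_i f (Some i).
Proof.
rewrite (bigD1 None)//=; congr (_ + _); rewrite (reindex_omap Some id); last by case.
by apply: eq_bigl => i; rewrite eqxx.
Qed.

Section riesz_product.
Context (R : realType) (T : finType).
Implicit Types (z : {ffun T -> bool * bool}) (p : T -> R[i]).

Definition riesz_kernel p z : R :=
  \prod_j (1 + complex.Re (p j * conjc (quarter (z j)))).

(** The three cases match the three terms of 1 + (p * conjc q + conjc p * q) / 2, a factor of the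
    Riesz product, so a map from [T] to [option bool] selects one term of its expansion. *)
Definition conj_power (o : option bool) (a : R[i]) : R[i] :=
  if o is Some b then (if b then a else conjc a) else 1.

Lemma riesz_kernel_ge0 p z : (forall j, cmod (p j) <= 1) -> 0 <= riesz_kernel p z.
Proof.
move=> p1; apply: prodr_ge0 => j _.
have := cmod_ge_Re (p j * conjc (quarter (z j))).
rewrite cmodM cmodJ cmod_quarter mulr1 => /le_trans /(_ (p1 j)).
by rewrite ler_norml -lerBlDl sub0r => /andP[].
Qed.

Lemma card_sign_vectors :
  #|{ffun T -> bool * bool}|%:R = \prod_(j : T) (4 : R[i]).
Proof. by rewrite card_ffun card_prod card_bool natrX prodr_const. Qed.

Lemma real_complex_prod (f : T -> R) : (\prod_j f j)%:C = \prod_j (f j)%:C :> R[i].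
Proof. exact: rmorph_prod. Qed.

(** The sum factors over coordinates. In one coordinate, [quarter] has mean 0, mean square 0 and
    mean squared modulus 1; mean square 0 removes the conjugate of [p j], which real signs would
    retain. *)
Lemma riesz_kernel_coef p (S : {set T}) :
  \sum_(z : {ffun T -> bool * bool})
    (\prod_(j in S) quarter (z j)) * (riesz_kernel p z)%:C
  = #|{ffun T -> bool * bool}|%:R * \prod_(j in S) (p j / 2).
Proof.
pose g j e : R[i] := (if j \in S then quarter e else 1) *
  (1 + complex.Re (p j * conjc (quarter e)))%:C.
transitivity (\sum_(z : {ffun T -> bool * bool}) \prod_j g j (z j)).
  apply: eq_bigr => z _; rewrite big_mkcond /riesz_kernel /=.
  by rewrite real_complex_prod -big_split.
rewrite -bigA_distr_bigA card_sign_vectors [X in _ = _ * X]big_mkcond -big_split /=.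
apply: eq_bigr => j _; rewrite sum_quarter /g !quarterE.
case: (p j) => a b; case: ifP => _; apply/eqP; rewrite eq_complex /=.
  by apply/andP; split; apply/eqP => /=; field.
by apply/andP; split; apply/eqP => /=; ring.
Qed.

Lemma riesz_kernel_sum p : \sum_z riesz_kernel p z = #|{ffun T -> bool * bool}|%:R.
Proof.
apply: complexI; have := riesz_kernel_coef p finset.set0.
rewrite big_set0 mulr1 rmorph_nat rmorph_sum /= => <-.
by apply: eq_bigr => z _; rewrite big_set0 mul1r.
Qed.

(** Multiplying out the factors separates [z] from [p], so that weak multiplicativity can be applied
    to each term when [p] depends on [x]. *)
Lemma riesz_kernel_expand p z :
  (riesz_kernel p z)%:C = \sum_(e : {ffun T -> option bool})
    (\prod_j
      (if e j is Some b then conj_power (Some (~~ b)) (quarter (z j)) / 2 else 1))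
    * \prod_j conj_power (e j) (p j).
Proof.
rewrite /riesz_kernel real_complex_prod.
pose h j o : R[i] :=
  (if o is Some b then conj_power (Some (~~ b)) (quarter (z j)) / 2 else 1)
   * conj_power o (p j).
under [RHS]eq_bigr do rewrite -big_split.
rewrite -(bigA_distr_bigA h) /=; apply: eq_bigr => j _.
rewrite /h sum_option big_bool /= mul1r.
case: (p j) (quarter (z j)) => [a b] [a' b']; apply/eqP; rewrite eq_complex /=.
by apply/andP; split; apply/eqP => /=; field.
Qed.

End riesz_product.

(** * Moments of polynomials in a weakly multiplicative system *)

Section weakly_multiplicative.
Context (R : realType) (d : measure_display) (X : measurableType d).
Context (mu : {measure set X -> \bar R}) (mu1 : mu setT = 1%E).
Context (T : finType) (phi : T -> X -> R[i]).
Context (phi_meas : forall j, cbounded_measurable (phi j)).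
Context (phi_le1 : forall j x, cmod (phi j x) <= 1).
(** A vanishing complex mean, expressed by real integrals: varying [a] covers the imaginary part
    too. *)
Context (phi_mult : forall (e : {ffun T -> option bool}) (a : R[i]),
  (exists j, e j != None) ->
  \int[mu]_x complex.Re (a * \prod_j conj_power (e j) (phi j x)) = 0).

Let kernel z x := riesz_kernel (fun j => phi j x) z.

Let monomial_meas (e : {ffun T -> option bool}) (a : R[i]) :
  bounded_measurable (fun x => complex.Re (a * \prod_j conj_power (e j) (phi j x))).
Proof.
suff [] : cbounded_measurable (fun x => a * \prod_j conj_power (e j) (phi j x)) by [].
apply: cbounded_measurableM; first exact: cbounded_measurable_cst.
apply: cbounded_measurable_prod => j; case: (e j) => [[]|] //=.
- exact: cbounded_measurableJ.
- exact: cbounded_measurable_cst.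
Qed.

Let kernelE z : exists2 a : {ffun T -> option bool} -> R[i],
  a [ffun=> None] = 1 &
  kernel z = fun x => \sum_e complex.Re (a e * \prod_j conj_power (e j) (phi j x)).
Proof.
exists (fun e : {ffun T -> option bool} => \prod_j
  (if e j is Some b then conj_power (Some (~~ b)) (quarter (z j)) / 2 else 1)).
  by rewrite big1// => j _; rewrite ffunE.
by apply/funext => x; rewrite -Re_sum -riesz_kernel_expand.
Qed.

Let kernel_meas z : bounded_measurable (kernel z).
Proof. by have [a _ ->] := kernelE z; exact: bounded_measurable_sum. Qed.

(** Weak multiplicativity annihilates every term of the expansion but the constant one. *)
Let kernel_integral z : \int[mu]_x kernel z x = 1.
Proof.
have [a a1 ->] := kernelE z; rewrite Rintegral_sum//.
rewrite (bigD1 [ffun=> None])//= a1 [X in _ + X]big1 => [|e e0]; last first.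
  apply: phi_mult; apply/existsP; rewrite -negb_forall.
  apply: contra e0 => /forallP e0; apply/eqP/ffunP => j; rewrite ffunE.
  exact/eqP.
rewrite addr0 (_ : (fun x => _) = cst 1).
  by rewrite Rintegral_cst// mu1 mulr1.
by apply/funext => x; rewrite big1 ?mulr1// => j _; rewrite ffunE.
Qed.

(* [4 ^ #|S|] is the square of the factor [2 ^ #|S|] lost when [phi_S] is
   recovered from the Riesz product. *)
Lemma weakly_multiplicative_norm (c : {set T} -> R[i]) (m : nat) :
  \int[mu]_x cmod (\sum_(S : {set T}) c S * \prod_(j in S) phi j x) ^+ (2 ^ m.+1)
  <= (\sum_(S : {set T}) (4 * (2 ^+ m.+1 - 1)) ^+ #|S| * cmod (c S) ^+ 2) ^+ (2 ^ m).
Proof.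
pose M : R := #|{ffun T -> bool * bool}|%:R.
have N0 : (0 < #|{ffun T -> bool * bool}|)%N.
  by rewrite card_ffun card_prod card_bool expn_gt0.
have M0 : 0 < M by rewrite ltr0n.
pose F z := multilinear (fun S : {set T} => 2 ^+ #|S| * c S) finset.setT z.
have FE x : \sum_(S : {set T}) c S * \prod_(j in S) phi j x
    = \sum_z (M^-1 * kernel z x)%:C * F z.
  rewrite /F /multilinear powersetT.
  under [RHS]eq_bigr do rewrite mulr_sumr.
  rewrite exchange_big /= [RHS]big_mkcond /=; apply: eq_bigr => S _.
  rewrite inE (eq_bigr (fun z : {ffun T -> bool * bool} => (2 ^+ #|S| * c S * M^-1%:C)
      * ((\prod_(j in S) quarter (z j)) * (kernel z x)%:C))); last first.
    by move=> z _; rewrite rmorphM; ring.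
  rewrite -mulr_sumr riesz_kernel_coef big_split /= prodr_const.
  rewrite exprVn fmorphV -(rmorph_nat (real_complex R)) -/M.
  by field; rewrite expf_neq0 ?(inj_eq (@complexI R)) ?pnatr_eq0 -?lt0n.

(* For fixed [x] these weights are a probability distribution in [z], so Jensen applies pointwise.
   Integrating in [x] then replaces the kernel by 1 and leaves a uniform average over [z]. *)
pose w (x : X) z := M^-1 * kernel z x.
have w0 x z : 0 <= w x z.
  by apply: mulr_ge0; [rewrite invr_ge0 ltW|exact: riesz_kernel_ge0].
have w1 x : \sum_z w x z = 1.
  by rewrite -mulr_sumr riesz_kernel_sum mulVf ?gt_eqF.
have Fle x : cmod (\sum_(S : {set T}) c S * \prod_(j in S) phi j x) ^+ (2 ^ m.+1)
    <= \sum_z M^-1 * cmod (F z) ^+ (2 ^ m.+1) * kernel z x.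
  apply: (@le_trans _ _ ((\sum_z w x z * cmod (F z)) ^+ (2 ^ m.+1))).
    apply: lerXn2r; rewrite ?nnegrE ?cmod_ge0//.
      by apply: sumr_ge0 => z _; apply: mulr_ge0; [exact: w0|exact: cmod_ge0].
    rewrite FE; apply: le_trans (cmod_sum _ _) _; apply: ler_sum => z _.
    by rewrite cmodM cmod_real//; exact: w0.
  apply: le_trans (pow2_jensen _ _ (w0 x) (w1 x)) _.
  by rewrite ler_sum// => z _; rewrite /w mulrAC.
have Km z : bounded_measurable
    (fun x => M^-1 * cmod (F z) ^+ (2 ^ m.+1) * kernel z x).
  by apply: bounded_measurableM => //; exact: bounded_measurable_cst.
apply: le_trans (le_Rintegral _ _ _ (fun x _ => Fle x)) _ => //.
- apply: bounded_measurable_integrable => //.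
  apply: bounded_measurable_cmod; apply: cbounded_measurable_sum => S.
  apply: cbounded_measurableM; first exact: cbounded_measurable_cst.
  exact: cbounded_measurable_prod.
- by apply: bounded_measurable_integrable => //; exact: bounded_measurable_sum.
rewrite Rintegral_sum//.
under eq_bigr do rewrite RintegralZ// kernel_integral mulr1.
rewrite -mulr_sumr -ler_pdivlMl ?invr_gt0// invrK.
apply: le_trans (hypercontractivity _ _ _) _.
apply: ler_wpM2l; first exact: ltW.
rewrite le_eqVlt; apply/orP; left; apply/eqP; congr (_ ^+ _).
rewrite powersetT big_mkcond /=; apply: eq_bigr => S _; rewrite inE.
rewrite cmodM exprMn (_ : 2 ^+ #|S| = (2 ^+ #|S|)%:C); last first.
  by rewrite rmorphXn rmorph_nat.
rewrite cmod_real ?exprn_ge0// exprMn mulrA; congr (_ * _).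
by rewrite mulrC exprAC (_ : 2 ^+ 2 = 4) ?expr2 -?natrM.
Qed.

End weakly_multiplicative.

(** * Characters and Haar measure *)

Section haar.
Context (R : realType) (G : topologicalZmodType).
Context (mu : {measure set (borelType G) -> \bar R}).
Context (haar_mu : normalized_haar mu).

Let mu1 : mu setT = 1%E. Proof. by case: haar_mu. Qed.

Lemma open_borel (U : set G) : open U -> @measurable _ (borelType G) U.
Proof. by move=> oU; exact: sub_sigma_algebra. Qed.

Lemma continuous_borel_measurable (f : G -> R) : continuous f ->
  measurable_fun setT (f : borelType G -> R).
Proof.
move=> /continuousP cf; apply: (measurability _ (RGenOpens.measurableE R)).
by move=> _ [_ [a [b ->]] <-]; rewrite setTI; apply: open_borel; exact: cf.
Qed.

Lemma character_measurable (chi : G -> R[i]) : is_character chi ->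
  cbounded_measurable (chi : borelType G -> R[i]).
Proof.
move=> [cchi _ chi1].
(* Real and imaginary parts are treated together as additive maps dominated by the modulus. *)
have cont (p : R[i] -> R) : (forall a b, p (a - b) = p a - p b) ->
    (forall a, `|p a| <= cmod a) -> continuous (p \o chi).
  move=> pB p_le x; apply/cvgrPdist_lt => e e0.
  have /cvgrPdist_lt/(_ e%:C) := cchi x; rewrite ltcR => /(_ e0).
  apply: filterS => y; rewrite /= -pB => h.
  by apply: le_lt_trans (p_le _) _; rewrite -ltcR.
have cmod_chi x : cmod (chi x) = 1.
  by apply: complexI; rewrite -[RHS](chi1 x).
split; split.
- apply: continuous_borel_measurable; apply: (cont (@complex.Re R)).
    by case=> ? ? [].
  exact: cmod_ge_Re.
- by exists 1 => x; rewrite -(cmod_chi x); exact: cmod_ge_Re.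
- apply: continuous_borel_measurable; apply: (cont (@complex.Im R)).
    by case=> ? ? [].
  exact: cmod_ge_Im.
- by exists 1 => x; rewrite -(cmod_chi x); exact: cmod_ge_Im.
Qed.

(** The push-forward of [mu] under translation by [g] is [mu], since the preimage of a Borel set is
    its translate by [- g]; change of variables passes from sets to integrals. *)
Lemma haar_translation (f : borelType G -> R) (g : G) : bounded_measurable f ->
  \int[mu]_x f (g + x) = \int[mu]_x f x.
Proof.
move=> bf; pose phi (x : borelType G) : borelType G := (g : G) + (x : G).
have mphi : measurable_fun setT phi.
  apply: (measurability (@open G : set (set (borelType G))) erefl) => _ [U oU <-].
  rewrite setTI; apply: open_borel; move: U oU; apply/continuousP => x.
  apply: (@continuous_comp _ _ _ (fun y : G => (g, y)) (fun y : G * G => y.1 + y.2)).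
    by apply: cvg_pair => /=; [exact: cvg_cst|exact: cvg_id].
  exact: add_continuous.
have [_ inv _ _] := haar_mu.
have pushE A : measurable A -> pushforward mu phi A = mu A.
  move=> mA; rewrite -(inv (- g) A)//; congr (mu _).
  apply/seteqP; split => [x /= Ax|_ [x Ax <-]]; last by rewrite /= /phi addrA subrr add0r.
  by exists (phi x) => //; rewrite /phi addrA addNr add0r.
have [mf _] := bf.
rewrite /Rintegral; congr fine.
have := @integral_pushforward _ _ _ _ _ phi mphi mu setT (EFin \o f).
rewrite preimage_setT => <-//.
- apply: eq_measure_integral => A mA _; exact: pushE.
- exact/measurable_EFinP.
apply: bounded_measurable_integrable => //; split.
  exact: measurableT_comp.
by have [_ [M fM]] := bf; exists M => x; exact: fM.
Qed.

(** Translation by [g] multiplies [h] by [h g]. With [b = a / (h g - 1)], one has [a = b * h g - b],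
    and the integral becomes a difference of two equal ones. *)
Lemma character_orthogonality (h : G -> R[i]) (a : R[i]) :
  cbounded_measurable (h : borelType G -> R[i]) ->
  {morph h : x y / x + y >-> x * y} -> (exists g, h g != 1) ->
  \int[mu]_x complex.Re (a * h x) = 0.
Proof.
move=> bh hM [g hg].
have meas b : bounded_measurable (fun x : borelType G => complex.Re (b * h x)).
  suff [] : cbounded_measurable (fun x : borelType G => b * h x) by [].
  by apply: cbounded_measurableM => //; exact: cbounded_measurable_cst.
have inv b : \int[mu]_x complex.Re (b * h g * h x) = \int[mu]_x complex.Re (b * h x).
  rewrite -[RHS](haar_translation g)//.
  by apply: eq_Rintegral => x _; rewrite hM mulrA.
have hg0 : h g - 1 != 0 by rewrite subr_eq0.
pose b := a / (h g - 1).
rewrite (_ : a = b * h g - b); last first.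
  by rewrite -{2}[b]mulr1 -mulrBr /b divfK.
transitivity (\int[mu]_x (complex.Re (b * h g * h x) - complex.Re (b * h x))).
  by apply: eq_Rintegral => x _; rewrite mulrBl; case: (_ * _) (_ * _) => ? ? [].
rewrite RintegralB// ?inv ?subrr//; exact: bounded_measurable_integrable.
Qed.

End haar.

(** * From even to real exponents *)

Section Lnorm_bound.
Context (R : realType) (d : measure_display) (X : measurableType d).
Context (mu : {measure set X -> \bar R}) (mu1 : mu setT = 1%E).

(** Stands in for Hölder's inequality: the first summand serves [t <= b], the second [b < t], where
    [b^-1 * t >= 1] allows raising the exponent. *)
Lemma powR_le_exprn (q b t : R) (n : nat) : 0 < q -> q <= n%:R -> 0 < b -> 0 <= t ->
  t `^ q <= b `^ q * (1 + (b^-1) ^+ n * t ^+ n).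
Proof.
move=> q0 qn b_gt0 t0; have b0 := ltW b_gt0; have bV0 : 0 <= b^-1 by rewrite invr_ge0.
have bq0 : 0 <= b `^ q by exact: powR_ge0.
have [tb|bt] := leP t b.
  apply: (@le_trans _ _ (b `^ q)); first by rewrite ge0_ler_powR ?nnegrE// ltW.
  by rewrite ler_peMr// lerDl mulr_ge0 ?exprn_ge0.
have bt1 : 1 <= b^-1 * t by rewrite mulrC ler_pdivlMr// mul1r ltW.
have bt0 : 0 <= b^-1 * t by exact: le_trans bt1.
rewrite -exprMn -{1}(mulVKf (lt0r_neq0 b_gt0) t) powRM// ler_wpM2l// -powR_mulrn//.
by rewrite (le_trans (ler_powR bt1 qn))// lerDr.
Qed.

Lemma Lnorm_le (h : X -> R[i]) (q B : R) (n : nat) :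
  cbounded_measurable h -> 1 <= q -> q <= n%:R -> 0 <= B ->
  \int[mu]_x cmod (h x) ^+ n <= B ^+ n ->
  (Lnorm mu q%:E (fun x => (cmod (h x))%:E) <= (2 * B)%:E)%E.
Proof.
move=> bh q1 qn B0 hB; have q0 : 0 < q by exact: lt_le_trans q1.
apply/lee_addgt0Pr => e e0.
(* The increment makes [b] positive even when [B] is 0, and doubling it restores [e]. *)
pose b := B + e / 2; have b0 : 0 < b by rewrite ltr_wpDl// divr_gt0.
rewrite -EFinD (_ : 2 * B + e = 2 * b); last by rewrite /b; field.
have {hB} hb : \int[mu]_x cmod (h x) ^+ n <= b ^+ n.
  have Bb : B <= b by rewrite lerDl ltW// divr_gt0.
  by apply: le_trans hB _; apply: lerXn2r; rewrite ?nnegrE//; exact: ltW.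
have mh : measurable_fun setT (fun x => cmod (h x)).
  by have [] := bounded_measurable_cmod 1 bh.
have bn := bounded_measurable_cmod n bh.
have bg : bounded_measurable (fun x => b `^ q * (1 + b^-1 ^+ n * cmod (h x) ^+ n)).
  apply: bounded_measurableM; first exact: bounded_measurable_cst.
  apply: bounded_measurableD; first exact: bounded_measurable_cst.
  by apply: bounded_measurableM => //; exact: bounded_measurable_cst.
have int_le : (\int[mu]_x (`|(cmod (h x))%:E| `^ q) <= ((2 * b) `^ q)%:E)%E.
  apply: (@le_trans _ _ (\int[mu]_x (b `^ q * (1 + b^-1 ^+ n * cmod (h x) ^+ n))%:E)%E).
    apply: ge0_le_integral => //.
    - by move=> x _; exact: poweR_ge0.
    - under eq_fun do rewrite /= ger0_norm ?cmod_ge0//.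
      apply/measurable_EFinP.
      exact: (measurableT_comp (measurable_powR q)).
    - by apply/measurable_EFinP; have [] := bg.
    move=> x _; rewrite /= ger0_norm ?cmod_ge0// lee_fin.
    by apply: powR_le_exprn => //; exact: cmod_ge0.
  rewrite -[leLHS]fineK; last first.
    by apply: integrable_fin_num => //; exact: bounded_measurable_integrable.
  rewrite lee_fin -/(Rintegral _ _ _).
  have bc := @bounded_measurable_cst R d X.
  rewrite RintegralZ//; last first.
    by apply: bounded_measurableD => //; exact: bounded_measurableM.
  have bnn := bounded_measurableM (bc (b^-1 ^+ n)) bn.
  rewrite RintegralD//; [|exact: bounded_measurable_integrable..].
  rewrite RintegralZ// Rintegral_cst// mu1 mulr1.
  apply: (@le_trans _ _ (b `^ q * 2)).
    rewrite ler_wpM2l ?powR_ge0// -[leRHS]/(1 + 1) lerD2l.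
    by rewrite exprVn ler_pdivrMl ?exprn_gt0// mulr1.
  (* The factor 2 is at most its own [q]-th power because [1 <= q]. *)
  rewrite powRM//; last exact: ltW.
  rewrite mulrC ler_wpM2r ?powR_ge0//.
  by rewrite -[leLHS]powRr1// ler_powR// ler1n.
rewrite unlock.
apply: (@le_trans _ _ (((2 * b) `^ q)%:E `^ q^-1)%E).
  apply: gt0_ler_poweR => //; rewrite ?invr_ge0 ?(ltW q0)// in_itv/= leey andbT.
    by apply: integral_ge0 => x _; rewrite lee_fin powR_ge0.
  by rewrite lee_fin powR_ge0.
by rewrite poweR_EFin -powRrM divff ?gt_eqF// powRr1// mulr_ge0// ltW.
Qed.

End Lnorm_bound.

(** * Polynomial chaos *)

Section random_exponents.
Context (R : realType) (G : topologicalZmodType) (gamma : nat -> G -> R[i]) (d N : nat).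
Implicit Types (k : d.-tuple 'I_N.+1) (kappa : {ffun 'I_N.+1 -> 'I_d}).

(* The exponent of [gamma j] is [(kappa j).+1], which ranges over 1, ..., d.
   Trivial powers are replaced by 0: they break weak multiplicativity, and the
   primed sum never meets them. *)
Definition char_power kappa (j : 'I_N.+1) (x : G) : R[i] :=
  if `[< forall y, gamma j y ^+ (kappa j).+1 = 1 >] then 0
  else gamma j x ^+ (kappa j).+1.

(** A trivial selected power makes the product 0. Otherwise the product is multiplicative, and were
    it identically 1, dissociation would make the selected power at [j0] trivial; so orthogonality
    applies. *)
Lemma dissociated_char_power (mu : {measure set (borelType G) -> \bar R})
    kappa (e : {ffun 'I_N.+1 -> option bool}) (a : R[i]) :
  normalized_haar mu -> dissociated_system d gamma -> (exists j, e j != None) ->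
  \int[mu]_x complex.Re (a * \prod_j conj_power (e j) (char_power kappa j x)) = 0.
Proof.
move=> haar_mu [chi_gamma gamma_inj dis] [j0 ej0].
have [[j ej triv]|ntriv] := pselect (exists2 j, e j != None &
    forall y, gamma j y ^+ (kappa j).+1 = 1).
  rewrite (_ : (fun x => _) = cst 0) ?Rintegral_cst ?mul0r//.
  apply/funext => x; rewrite (bigD1 j)//= [X in _ * (X * _)](_ : _ = 0) ?mul0r ?mulr0//.
  by rewrite /char_power asboolT//; case: (e j) ej => [[]|]// _; exact: conjc0.
pose h (x : G) := \prod_j conj_power (e j) (gamma j x ^+ (kappa j).+1).
transitivity (\int[mu]_x complex.Re (a * h x)).
  apply: eq_Rintegral => x _; congr (complex.Re (_ * _)); apply: eq_bigr => j _.
  rewrite /char_power; case: asboolP => // triv.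
  by case ej : (e j) => [b|//]; case: ntriv; exists j => //; rewrite ej.
have gM (j : 'I_N.+1) x y : gamma j (x + y) = gamma j x * gamma j y.
  by have [_ ->] := chi_gamma j.
apply: (character_orthogonality haar_mu).
- apply: cbounded_measurable_prod => j.
  have hp : cbounded_measurable (fun x : borelType G => gamma j x ^+ (kappa j).+1).
    rewrite (_ : (fun x => _) = (fun x => \prod_(i < (kappa j).+1) gamma j x)).
      by apply: cbounded_measurable_prod => _; exact: character_measurable.
    by apply/funext => x; rewrite prodr_const card_ord.
  case: (e j) => [[]|] //=; last exact: cbounded_measurable_cst.
  exact: cbounded_measurableJ.
- move=> x y; rewrite /h -big_split; apply: eq_bigr => j _ /=.
  by rewrite gM exprMn; case: (e j) => [[]|] //=; rewrite ?mulr1// rmorphM.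
apply: contrapT => hall.
(* On the unit circle conjugation is inversion, hence the negative sign; [(kappa j).+1 <= d] keeps
   the exponents in the range of [d]-dissociation. *)
pose l (j : 'I_N.+1) : int := if e j is Some b then
  (if b then (kappa j).+1%:Z else - (kappa j).+1%:Z) else 0.
have lE j x : conj_power (e j) (gamma j x ^+ (kappa j).+1) = gamma j x ^ l j.
  rewrite /l; case: (e j) => [[]|] //=.
  have [_ _ /(_ x) g1] := chi_gamma j.
  by rewrite -[LHS]mul1r -exprnN invc_norm normrX g1 expr1n expr1n invr1 mul1r.
have hx x : h x = 1 by apply: contrapT => /eqP hx; apply: hall; exists x.
have [_ /(_ l) dis_l] := dis _ (fun j : 'I_N.+1 => gamma j)
  (fun i j ij => val_inj (gamma_inj _ _ ij)) (fun j => ex_intro2 _ _ _ I erefl).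
have {dis_l} l1 : forall x, gamma j0 x ^ l j0 = 1.
  apply: dis_l => [j|x].
    by rewrite /l; have := ltn_ord (kappa j); case: (e j) => [[]|]; lia.
  by rewrite -[RHS](hx x); apply: eq_bigr => j _; rewrite lE.
apply: ntriv; exists j0 => // y; have := lE j0 y; rewrite l1.
by case: (e j0) ej0 => [[]|] //= _ /(congr1 conjc); rewrite conjcK conjc1.
Qed.

Lemma prod_count_mem (T : finType) (s : seq T) (f : T -> R[i]) :
  \prod_(i <- s) f i = \prod_j f j ^+ count_mem j s.
Proof.
elim: s => [|a s IH]; first by rewrite big_nil big1.
rewrite big_cons IH; under [RHS]eq_bigr do rewrite /= exprD.
rewrite big_split /=; congr (_ * _); rewrite (bigD1 a)//= eqxx expr1 big1 ?mulr1// => j.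
by rewrite eq_sym => /negPf ->.
Qed.

(* Importance weight of the monomial [k]: the inverse probability
   [d ^ #|index_support k|] of the event that [kappa] matches the multiplicities
   in [k], on that event, and 0 outside it. *)
Definition weight kappa k : nat :=
  \prod_j if j \in k then (((kappa j).+1 == count_mem j k) * d)%N else 1%N.

Definition index_support k : {set 'I_N.+1} := [set j in k].

Lemma card_index_support k : (#|index_support k| <= d)%N.
Proof. by rewrite cardsE (leq_trans (card_size _)) ?size_tuple. Qed.

Lemma weight_le kappa k : (weight kappa k <= d ^ #|index_support k|)%N.
Proof.
rewrite -sum1_card (big_morph _ (expnD d) (expn0 d)) [leqRHS]big_mkcond.
apply: leq_prod => j _; rewrite inE; case: ifP => // _.
by rewrite expn1; case: (_ == _); rewrite ?mul1n ?mul0n.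
Qed.

Lemma weight_neq0 kappa k j : weight kappa k != 0%N -> j \in k ->
  (kappa j).+1 = count_mem j k.
Proof.
by rewrite -lt0n => /gt0_prodn /(_ j isT) + jk; rewrite jk; case: eqP.
Qed.

(** Says that the average weight is 1. The sum factors over [j], each factor being [d]: for [j] in
    [k] the multiplicity lies between 1 and [d], so exactly one exponent matches it; otherwise there
    are [d] terms equal to 1. *)
Lemma sum_weight k : (\sum_kappa weight kappa k = d ^ N.+1)%N.
Proof.
pose F j (l : 'I_d) := if j \in k then ((l.+1 == count_mem j k) * d)%N else 1%N.
transitivity (\prod_(j < N.+1) d)%N; last by rewrite prod_nat_const card_ord.
rewrite -(bigA_distr_bigA F) /=.
apply: eq_bigr => j _; rewrite /F; have [jk|jk] := boolP (j \in k); last first.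
  by rewrite sum1_card card_ord.
have c0 : (0 < count_mem j k)%N by rewrite lt0n; apply: contraL jk => /eqP/count_memPn.
have cd : ((count_mem j k).-1 < d)%N.
  by rewrite prednK// (leq_trans (count_size _ _)) ?size_tuple.
rewrite (bigD1 (Ordinal cd))//= prednK// eqxx mul1n big1 ?addn0// => i.
by rewrite -val_eqE /= => /negPf; rewrite -eqSS prednK// => ->.
Qed.

(* Given [kappa], a monomial is determined by its support, so each coefficient
   [chaos_coef kappa S] comes from at most one term. *)
Lemma chaos_index_inj kappa k k' : chaos_index gamma k -> chaos_index gamma k' ->
  weight kappa k != 0%N -> weight kappa k' != 0%N ->
  index_support k = index_support k' -> k = k'.
Proof.
move=> /andP[sk _] /andP[sk' _] wk wk' /setP kk'.
apply: val_inj; apply: (inj_map val_inj).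
apply: (sorted_eq leq_trans anti_leq) => //; apply: perm_map.
apply/allP => j _ /=; have := kk' j; rewrite !inE.
have [jk /esym jk'|jk /esym/negbT jk'] := boolP (j \in k).
  by rewrite -(weight_neq0 wk jk) -(weight_neq0 wk' jk').
by rewrite (count_memPn jk) (count_memPn jk').
Qed.

(** A trivial positive power bounds the order from above, contrary to the strict inequality in
    [chaos_index]. *)
Lemma chaos_index_nontrivial k j : chaos_index gamma k -> j \in k ->
  ~ forall y, gamma j y ^+ count_mem j k = 1.
Proof.
move=> /andP[_ /forallP /(_ j) /asboolP +] jk triv; apply/negP; rewrite -leNgt.
by apply: ereal_inf_lbound; exists (count_mem j k) => //; split => //;
  rewrite lt0n; apply: contraL jk => /eqP/count_memPn.
Qed.

End random_exponents.

(** * The chaos polynomial as an average of multilinear polynomials *)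

Section chaos_decomposition.
Context (R : realType) (G : topologicalZmodType) (gamma : nat -> G -> R[i]) (d N : nat).
Context (A : d.-tuple 'I_N.+1 -> R[i]).
Implicit Types (k : d.-tuple 'I_N.+1) (kappa : {ffun 'I_N.+1 -> 'I_d}).

Definition chaos_coef kappa (S : {set 'I_N.+1}) : R[i] :=
  \sum_(k | chaos_index gamma k && (index_support k == S)) A k * (weight kappa k)%:R.

Definition multilinear_part kappa (x : G) : R[i] :=
  \sum_S chaos_coef kappa S * \prod_(j in S) char_power gamma kappa j x.

(** Where the weight is nonzero, the exponents given by [kappa] are the multiplicities in [k], so
    the product over the support is the monomial itself. *)
Lemma multilinear_partE kappa x : multilinear_part kappa x =
  \sum_(k | chaos_index gamma k)
    (weight kappa k)%:R * (A k * \prod_(i < d) gamma (tnth k i) x).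
Proof.
rewrite (partition_big (@index_support d N) predT)//=; apply: eq_bigr => S _.
rewrite mulr_suml; apply: eq_bigr => k /andP[ck /eqP <-].
have [->|wk] := eqVneq (weight kappa k) 0%N; first by rewrite mulr0 !mul0r.
rewrite mulrAC mulrC; congr (_ * (_ * _)).
rewrite -(big_tuple _ _ k predT (fun j : 'I_N.+1 => gamma j x)) prod_count_mem.
rewrite big_mkcond; apply: eq_bigr => j _; rewrite inE.
have [jk|/count_memPn ->] := boolP (j \in k); last by rewrite expr0.
have kj := weight_neq0 wk jk.
by rewrite /char_power asboolF kj//; exact: chaos_index_nontrivial ck jk.
Qed.

Lemma chaos_polyE x : (0 < d)%N ->
  chaos_poly gamma A x =
  \sum_kappa (#|{ffun 'I_N.+1 -> 'I_d}|%:R^-1)%:C * multilinear_part kappa x.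
Proof.
move=> d0; rewrite -mulr_sumr; under eq_bigr do rewrite multilinear_partE.
rewrite exchange_big /= mulr_sumr; apply: eq_bigr => k _.
rewrite -mulr_suml -natr_sum sum_weight mulrA card_ffun !card_ord.
rewrite fmorphV rmorph_nat mulVf ?mul1r//.
by rewrite pnatr_eq0 expn_eq0 negb_and -lt0n d0.
Qed.

(** By [chaos_index_inj] a coefficient is 0 or a single [A k] times a weight of at most [d ^ #|S|];
    since [#|S| <= d], the total factor is at most [(K * d%:R ^+ 2) ^+ d]. *)
Lemma chaos_coef_sum_le kappa (K : R) : (0 < d)%N -> 1 <= K ->
  \sum_(S : {set 'I_N.+1}) K ^+ #|S| * cmod (chaos_coef kappa S) ^+ 2
  <= (K * d%:R ^+ 2) ^+ d * \sum_(k | chaos_index gamma k) cmod (A k) ^+ 2.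
Proof.
move=> d0 K1; have K0 : 0 <= K by exact: le_trans K1.
rewrite [X in _ * X](partition_big (@index_support d N) predT)//= mulr_sumr.
apply: ler_sum => S _.
have rhs0 : 0 <= (K * d%:R ^+ 2) ^+ d *
    \sum_(k | chaos_index gamma k && (index_support k == S)) cmod (A k) ^+ 2.
  apply: mulr_ge0; last by apply: sumr_ge0 => k _; exact: sqr_ge0.
  by apply: exprn_ge0; apply: mulr_ge0 => //; exact: exprn_ge0.
have [[k [ck /eqP kS wk]]|none] := pselect (exists k,
    [/\ chaos_index gamma k, index_support k == S & weight kappa k != 0%N]); last first.
  rewrite /chaos_coef big1 ?cmod0 ?expr0n ?mulr0// => k /andP[ck kS].
  have [->|wk] := eqVneq (weight kappa k) 0%N; first by rewrite mulr0.
  by case: none; exists k.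
rewrite /chaos_coef (bigD1 k) ?ck ?kS ?eqxx//=.
rewrite big1 ?addr0 => [|k' /andP[/andP[ck' /eqP kS'] kk']]; last first.
  have [->|wk'] := eqVneq (weight kappa k') 0%N; first by rewrite mulr0.
  by move: kk'; rewrite (chaos_index_inj ck' ck wk' wk) ?eqxx// kS' kS.
rewrite cmodM (_ : (weight kappa k)%:R = ((weight kappa k)%:R)%:C); last first.
  by rewrite rmorph_nat.
rewrite cmod_real// exprMn mulrCA mulrC.
have Sd : (#|S| <= d)%N by rewrite -kS card_index_support.
apply: ler_pM.
- by apply: mulr_ge0; rewrite ?exprn_ge0.
- exact: sqr_ge0.
- rewrite exprMn; apply: ler_pM; rewrite ?exprn_ge0//.
    exact: ler_weXn2l.
  rewrite -exprM mulnC exprM lerXn2r ?nnegrE// ?exprn_ge0//.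
  rewrite -natrX ler_nat (leq_trans (weight_le _ _))// kS leq_pexp2l//.
by rewrite (bigD1 k) ?ck ?kS ?eqxx//= lerDl sumr_ge0// => k' _; exact: sqr_ge0.
Qed.

End chaos_decomposition.

(** * Lacunarity of the polynomial chaos *)

Theorem theorem2 (R : realType) (d : nat) (hd : (1 <= d)%N)
    (G : topologicalZmodType) (hausdorffG : hausdorff_space G)
    (compactG : compact [set: G])
    (mu : {measure set (borelType G) -> \bar R})
    (haar_mu : normalized_haar mu)
    (gamma : nat -> G -> R[i]) (gammaP : dissociated_system d gamma)
    (q : R) (hq : 2 < q) :
  exists2 C : R, 0 < C &
    forall (N : nat) (A : d.-tuple 'I_N.+1 -> R[i]),
      (complex_Lnorm mu q (chaos_poly gamma A) <=
       (C * Num.sqrt (\sum_(k : d.-tuple 'I_N.+1 | chaos_index gamma k)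
                        cmod (A k) ^+ 2))%:E)%E.
Proof.
have mu1 : mu setT = 1%E by case: haar_mu.
have [chi_gamma _ _] := gammaP.
have [m qm] : exists m, q <= (2 ^ m.+1)%:R.
  exists (Num.bound q); apply: le_trans (ltW (archi_boundP _)) _.
    by rewrite (le_trans _ (ltW hq)).
  by rewrite ler_nat (leq_trans (ltnW (ltn_expl _ (ltnSn 1))))// leq_pexp2l.
(* The cost per degree: 4 from the Riesz product and [2 ^+ m.+1 - 1] from hypercontractivity. [D]
   adds the cost of the weights; neither depends on [N] or [A]. *)
pose K : R := 4 * (2 ^+ m.+1 - 1).
have K1 : 1 <= K.
  have : 1 <= (2 : R) ^+ m by rewrite exprn_ege1// ler1n.
  by rewrite /K exprS; lra.
pose D := (K * d%:R ^+ 2) ^+ d.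
have D0 : 0 < D.
  by rewrite exprn_gt0// mulr_gt0 ?exprn_gt0 ?ltr0n// (lt_le_trans _ K1).
(* The 2 is the loss in [Lnorm_le] when passing from the exponent [2 ^ m.+1] to [q]. *)
exists (2 * Num.sqrt D); first by rewrite mulr_gt0// sqrtr_gt0.
move=> N A; rewrite -mulrA -sqrtrM; last exact: ltW.
set s := \sum_(k | _) _.
have s0 : 0 <= s by apply: sumr_ge0 => k _; exact: sqr_ge0.
have Ds0 : 0 <= D * s by rewrite mulr_ge0// ltW.
have char_meas j : cbounded_measurable (gamma j : borelType G -> R[i]).
  exact: character_measurable.
have char_power_meas (kappa : {ffun 'I_N.+1 -> 'I_d}) j :
    cbounded_measurable (char_power gamma kappa j : borelType G -> R[i]).
  rewrite /char_power; case: asboolP => _; first exact: cbounded_measurable_cst.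
  rewrite (_ : (fun x => _) = (fun x => \prod_(i < (kappa j).+1) gamma j x)).
    by apply: cbounded_measurable_prod => _.
  by apply/funext => x; rewrite prodr_const card_ord.
have char_power_le1 (kappa : {ffun 'I_N.+1 -> 'I_d}) (j : 'I_N.+1) x :
    cmod (char_power gamma kappa j x) <= 1.
  rewrite /char_power; case: asboolP => _; first by rewrite cmod0.
  have [_ _ /(_ x) g1] := chi_gamma j.
  by rewrite -lecR -[leLHS]/(`|gamma j x ^+ (kappa j).+1|) normrX g1 expr1n.
have part_meas kappa : cbounded_measurable
    (multilinear_part gamma A kappa : borelType G -> R[i]).
  apply: cbounded_measurable_sum => S; apply: cbounded_measurableM.
    exact: cbounded_measurable_cst.
  exact: cbounded_measurable_prod.
have chaos_meas : cbounded_measurable (chaos_poly gamma A : borelType G -> R[i]).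
  apply: cbounded_measurable_sum => k; apply: cbounded_measurableM.
    exact: cbounded_measurable_cst.
  exact: cbounded_measurable_prod.
rewrite /complex_Lnorm; apply: (Lnorm_le mu1 chaos_meas _ qm (sqrtr_ge0 _)).
  by rewrite (le_trans _ (ltW hq))// ler1n.
rewrite expnS exprM sqr_sqrtr//.
have part_le kappa : \int[mu]_x cmod (multilinear_part gamma A kappa x) ^+ (2 ^ m.+1)
    <= (D * s) ^+ (2 ^ m).
  have orth := fun e a => @dissociated_char_power _ _ _ _ _ _ kappa e a haar_mu gammaP.
  apply: (le_trans (weakly_multiplicative_norm mu1 (char_power_meas kappa)
    (char_power_le1 kappa) orth (chaos_coef gamma A kappa) m)).
  apply: lerXn2r; rewrite ?nnegrE//; last exact: chaos_coef_sum_le.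
  apply: sumr_ge0 => S _; apply: mulr_ge0; last exact: sqr_ge0.
  by rewrite exprn_ge0// (le_trans _ K1).
pose M : R := #|{ffun 'I_N.+1 -> 'I_d}|%:R.
have M0 : 0 < M by rewrite ltr0n card_ffun !card_ord expn_gt0 hd.
have MV0 : 0 <= M^-1 by rewrite invr_ge0 ltW.
have MV1 : \sum_(kappa : {ffun 'I_N.+1 -> 'I_d}) M^-1 = 1.
  by rewrite sumr_const -[LHS]mulr_natl mulfV// gt_eqF.
(* Jensen over uniform [kappa] suffices because the bound [part_le] is the same for every
   [kappa]. *)
have cmod_le x : cmod (chaos_poly gamma A x) ^+ (2 ^ m.+1) <=
    \sum_kappa M^-1 * cmod (multilinear_part gamma A kappa x) ^+ (2 ^ m.+1).
  apply: (le_trans _ (pow2_jensen _ _ (fun=> MV0) MV1)).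
  apply: lerXn2r; rewrite ?nnegrE ?cmod_ge0//.
    by apply: sumr_ge0 => kappa _; apply: mulr_ge0 => //; exact: cmod_ge0.
  rewrite chaos_polyE//; apply: (le_trans (cmod_sum _ _)).
  by apply: ler_sum => kappa _; rewrite cmodM cmod_real.
have part_bm kappa : bounded_measurable (fun x : borelType G =>
    M^-1 * cmod (multilinear_part gamma A kappa x) ^+ (2 ^ m.+1)).
  apply: bounded_measurableM; first exact: bounded_measurable_cst.
  exact: bounded_measurable_cmod.
rewrite -expnS.
apply: (@le_trans _ _ (\int[mu]_x
    \sum_kappa M^-1 * cmod (multilinear_part gamma A kappa x) ^+ (2 ^ m.+1))).
  apply: le_Rintegral => //.
    by apply: bounded_measurable_integrable => //; exact: bounded_measurable_cmod.
  by apply: bounded_measurable_integrable => //; exact: bounded_measurable_sum.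
rewrite Rintegral_sum// -[leRHS]mul1r -MV1 mulr_suml.
apply: ler_sum => kappa _; rewrite RintegralZ//; last exact: bounded_measurable_cmod.
exact: ler_wpM2l.
Qed.
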